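(* Assume $q>2$. For every integer $d\ge1$, $$\deg_\theta\big(\operatorname{BG}_{q^d-2}\big)=(d-1)q^d-\frac{2q(q^{d-1}-1)}{q-1}.$$
   Context: $A=\mathbb{F}_q[\theta]$, $A^+(k)$ the monic polynomials of degree $k$; $\operatorname{BG}_n=\sum_{k\ge0}\sum_{a\in A^+(k)}a^{n}\in A$ (a finite sum since the inner sums vanish for large $k$). *)

(* Defs.v *)
(* A = F_q[theta] is {poly F} for a finite field F with #|F| = q. *)
From HB Require Import structures.
From mathcomp Require Import all_boot all_order all_algebra.
Set Implicit Arguments. Unset Strict Implicit. Unset Printing Implicit Defensive.
Import GRing.Theory.
Local Open Scope ring_scope.

(* The monic polynomial of degree k with lower coefficients c_0..c_{k-1}:
   theta^k + sum_{i<k} c_i theta^i.  As c ranges over {ffun 'I_k -> F},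
   this ranges bijectively over A^+(k). *)
Definition monic_of (F : finFieldType) (k : nat) (c : {ffun 'I_k -> F}) : {poly F} :=
  'X^k + \sum_(i < k) (c i)%:P * 'X^i.

Definition powsum (F : finFieldType) (k n : nat) : {poly F} :=
  \sum_(c : {ffun 'I_k -> F}) (monic_of c) ^+ n.

(* BG_n = sum_{k >= 0} S_k(n); the inner sums vanish for k > n
   (indeed already for k(q-1) > n), so the sum over k <= n is the full sum. *)
Definition BG (F : finFieldType) (n : nat) : {poly F} :=
  \sum_(k < n.+1) powsum F k n.

(* Main.v *)
(** With P = \prod_(a monic of degree k) (X - a), N = q^k, and e the Carlitz
    polynomial vanishing on polynomials of degree < k, one has P = e - e(theta^k),
    where e is additive, e = X^N + (terms of degree at most N/q), and P' is a
    constant C.  Lagrange interpolation at the roots of P shows that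
    \sum_a f(a) is C times the coefficient of X^(N-1) in f when deg f < N; so
    \sum_a a^m = 0 for m < N - 1, which kills the terms k >= d of BG.
    For k = d - 1, raising P(a) = 0 to the q-th power
    gives a^(qN) = - P(0)^q - a^2 f(a) with deg f < N - 1; dividing by a^2 and using
    \sum_a a^-2 = (C / P(0))^2 yields the closed form
    \sum_a a^(qN-2) = - P(0)^(q-2) C^2.
    The terms k < d - 1 have degree at most (d-2)(q^d-2), which is smaller than the
    degree of this one as soon as q > 2. *)
Require Import Defs.
From HB Require Import structures.
From mathcomp Require Import all_boot all_order all_algebra.
From mathcomp Require Import pgroup abelian finfield.
From mathcomp Require Import zify ring.
Import GRing.Theory.
Local Open Scope ring_scope.

(** * Lagrange interpolation at the roots of a polynomial with constant derivative *)

Section Interpolation.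
Set Implicit Arguments. Unset Strict Implicit.
Variables (R : idomainType) (I : finType) (a : I -> R).
Hypothesis a_inj : injective a.

Let P := \prod_i ('X - (a i)%:P).
Let Q i := \prod_(j | j != i) ('X - (a j)%:P).

Let PE i : P = ('X - (a i)%:P) * Q i.
Proof. by rewrite /P (bigD1 i). Qed.

Let Q_other i j : j != i -> (Q i).[a j] = 0.
Proof. by move=> ji; rewrite /Q (bigD1 j)//= hornerM !hornerE subrr mul0r. Qed.

Let sizeP : size P = #|I|.+1.
Proof. by rewrite /P size_prod_XsubC cardT enumT. Qed.

Let sizeQ i : size (Q i) = #|I|.
Proof.
have := sizeP; rewrite (PE i) size_monicM ?monicXsubC //; last first.
  by rewrite monic_neq0 ?monic_prod_XsubC.
by rewrite size_XsubC => -[].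
Qed.

Variable C : R.
Hypothesis derP : P^`() = C%:P.

Let Q_self i : (Q i).[a i] = C.
Proof.
by rewrite -(hornerC C (a i)) -derP (PE i) derivM derivXsubC mul1r !hornerE subrr mul0r addr0.
Qed.

Lemma lagrange_interpolation (f : {poly R}) : (size f <= #|I|)%N ->
  \sum_i f.[a i] *: Q i = C *: f.
Proof.
move=> szf; apply/eqP; rewrite -subr_eq0; apply/eqP.
apply: (@roots_geq_poly_eq0 _ _ [seq a i | i <- enum I]).
- apply/allP => _ /mapP[i _ ->]; rewrite rootE hornerD hornerN horner_sum.
  rewrite (bigD1 i)//= big1 => [|j ji]; last by rewrite hornerZ Q_other ?mulr0 // eq_sym.
  by rewrite !hornerZ Q_self addr0 mulrC subrr.
- by rewrite map_inj_uniq ?enum_uniq.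
rewrite size_map -cardE (leq_trans (size_polyD _ _)) // size_polyN geq_max.
rewrite (leq_trans (size_scale_leq _ _)) // andbT.
apply: (leq_trans (size_sum _ _ _)); apply/bigmax_leqP => i _.
by rewrite (leq_trans (size_scale_leq _ _)) // sizeQ.
Qed.

(** Compare coefficients of degree [#|I|.-1] in the interpolation formula: each [Q i] is monic of
    that degree, which [f] does not reach. *)
Lemma sum_horner_eq0 (f : {poly R}) : (size f < #|I|)%N -> \sum_i f.[a i] = 0.
Proof.
move=> szf.
have /(congr1 (fun p : {poly R} => p`_#|I|.-1)) := lagrange_interpolation (ltnW szf).
rewrite coefZ [f`__]nth_default; last by rewrite -ltnS (ltn_predK szf).
rewrite mulr0 => E; rewrite -[RHS]E coef_sum; apply: eq_bigr => i _.
rewrite coefZ -(sizeQ i) -lead_coefE (eqP (monic_prod_XsubC _ _ _)) mulr1 //.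
Qed.

Hypothesis a_neq0 : forall i, a i != 0.

(* Up to the factor P(0)^2 the left-hand side is \sum_i (a i)^-2. *)
Let sum_Q0_sq : \sum_i (Q i).[0] ^+ 2 = C ^+ 2.
Proof.
(* [g] is (P - P(0))/X, so [g.[a i]] is -P(0)/(a i), that is [(Q i).[0]], and [g.[0]] is P'(0) =
   [C]. The claim is the interpolation formula for [g] evaluated at 0. *)
pose g := drop_poly 1 P.
have Pg : P = take_poly 1 P + g * 'X by rewrite -[LHS](poly_take_drop 1) expr1.
have take1 x : (take_poly 1 P).[x] = P.[0].
  rewrite horner_coef0; have -> : take_poly 1 P = (P`_0)%:P.
    by apply/polyP => -[|n]; rewrite coef_take_poly coefC.
  by rewrite hornerC.
have ga i : g.[a i] = (Q i).[0].
  apply: (mulIf (a_neq0 i)).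
  have /eqP : P.[a i] = 0 by rewrite (PE i) !hornerE subrr mul0r.
  rewrite {1}Pg hornerD hornerM hornerX take1 (PE i) !hornerE.
  by rewrite mulNr addrC subr_eq0 => /eqP ->; rewrite mulrC.
have szg : (size g <= #|I|)%N by rewrite /g size_drop_poly sizeP subn1.
have /(congr1 (fun p : {poly R} => p.[0])) := lagrange_interpolation szg.
rewrite horner_sum hornerZ => E; rewrite expr2.
have g0 : g.[0] = C.
  by rewrite -(hornerC C 0) -derP !horner_coef0 coef_deriv mulr1n coef_drop_poly.
by rewrite -{2}g0 -E; apply: eq_bigr => i _; rewrite hornerZ ga expr2.
Qed.

(** Dividing the hypothesis by the square of [a i] splits each power into an inverse square times
    [B] and a value of [f]; the latter sum to zero. The factor P(0)^2 clears the inverses, since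
    P(0) = - a i * (Q i)(0). *)
Lemma sum_expr_of_sq (m : nat) (B : R) (f : {poly R}) :
    (size f < #|I|)%N ->
    (forall i, a i ^+ m.+2 = B + a i ^+ 2 * f.[a i]) ->
  P.[0] ^+ 2 * (\sum_i a i ^+ m) = B * C ^+ 2.
Proof.
move=> szf am; have := sum_horner_eq0 szf => f0.
have E i : P.[0] ^+ 2 * a i ^+ m = B * (Q i).[0] ^+ 2 + P.[0] ^+ 2 * f.[a i].
  have -> : P.[0] = - (a i * (Q i).[0]) by rewrite (PE i) !hornerE mulNr.
  rewrite sqrrN exprMn mulrAC -exprD add2n am mulrDl; congr (_ + _).
  by rewrite mulrAC.
rewrite mulr_sumr (eq_bigr _ (fun i _ => E i)) big_split /= -!mulr_sumr.
by rewrite f0 mulr0 addr0 sum_Q0_sq.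
Qed.

End Interpolation.

(** * Monic polynomials of fixed degree: sizes and injectivity of the encoding *)

Section Monic.
Set Implicit Arguments. Unset Strict Implicit.
Variable F : finFieldType.
Implicit Types (k i n : nat).

Let tailE k (c : {ffun 'I_k -> F}) i :
  (\sum_(j < k) (c j)%:P * 'X^j)`_i = if insub i is Some j then c j else 0.
Proof.
rewrite coef_sum; case: insubP => [j _ <-|ik].
  rewrite (bigD1 j)//= coefCM coefXn eqxx mulr1 big1 ?addr0 // => l lj.
  by rewrite coefCM coefXn eq_sym val_eqE (negPf lj) mulr0.
rewrite big1 // => l _; rewrite coefCM coefXn; case: eqP => [il|]; last by rewrite mulr0.
by rewrite il ltn_ord in ik.
Qed.

Let size_tail k (c : {ffun 'I_k -> F}) : (size (\sum_(j < k) (c j)%:P * 'X^j)%R <= k)%N.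
Proof.
apply/leq_sizeP => i ki; rewrite tailE insubF //.
by apply/negbTE; rewrite -leqNgt.
Qed.

Lemma size_monic_of k (c : {ffun 'I_k -> F}) : size (monic_of c) = k.+1.
Proof. by rewrite /monic_of size_polyDl size_polyXn // ltnS size_tail. Qed.

Lemma monic_of_neq0 k (c : {ffun 'I_k -> F}) : monic_of c != 0.
Proof. by rewrite -size_poly_eq0 size_monic_of. Qed.

Lemma monic_of_inj k : injective (@monic_of F k).
Proof.
move=> c c' /addrI /polyP E; apply/ffunP => i.
by have := E i; rewrite !tailE valK.
Qed.

Lemma size_powsum_leq k n : (size (powsum F k n) <= (k * n).+1)%N.
Proof.
apply: (leq_trans (size_sum _ _ _)); apply/bigmax_leqP => c _.
by rewrite (leq_trans (size_poly_exp_leq _ _)) // size_monic_of.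
Qed.

End Monic.

(** * Frobenius and the Carlitz polynomials over A *)

Section Carlitz.
Set Implicit Arguments. Unset Strict Implicit.
Variable F : finFieldType.
Let q := #|F|.
Implicit Types (k i n : nat).

Let q_gt1 : (1 < q)%N.
Proof. exact: finNzRing_gt1. Qed.

Let q_gt0 : (0 < q)%N.
Proof. exact: ltnW. Qed.

Lemma pchar_nat_card_finField : [pchar F].-nat q.
Proof.
have [p pr_p pcharFp] := finPcharP F.
rewrite (eq_pnat _ (pcharf_eq pcharFp)) /q -cardsT.
exact: abelem_pgroup (fin_ring_pchar_abelem pcharFp).
Qed.

Lemma exprD_card (R : comNzRingType) : [pchar R] =i [pchar F] ->
  {morph (fun x : R => x ^+ q) : x y / x + y}.
Proof.
by move=> chR x y; apply: exprDn_pchar; rewrite (eq_pnat _ chR) pchar_nat_card_finField.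
Qed.

Let exprD1 : {morph (fun x : {poly F} => x ^+ q) : x y / x + y}.
Proof. by apply: exprD_card => p; rewrite pchar_poly. Qed.

Let exprD2 : {morph (fun x : {poly {poly F}} => x ^+ q) : x y / x + y}.
Proof. by apply: exprD_card => p; rewrite !pchar_poly. Qed.

Let natr_card (R : nzRingType) : [pchar R] =i [pchar F] -> q%:R = 0 :> R.
Proof.
have [p pr_p pcharFp] := finPcharP F => chR.
have pR : p \in [pchar R] by rewrite chR.
apply/eqP; rewrite -(dvdn_pcharf pR).
have := pchar_nat_card_finField; rewrite (eq_pnat _ (pcharf_eq pcharFp)).
case/p_natP => -[|e] qE; first by have := q_gt1; rewrite qE.
by rewrite qE expnS dvdn_mulr.
Qed.

(** The point ['X^k'] is theta^k'. Each step composes with Y^q - c^(q-1) Y, whose roots are the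
    F-multiples of c = e(theta^k'); this adjoins theta^k' to the space of roots. *)
Fixpoint carlitz k : {poly {poly F}} :=
  if k is k'.+1 then
    carlitz k' ^+ q - ((carlitz k').['X^k'] ^+ q.-1)%:P * carlitz k'
  else 'X.

(** Carlitz's D_k, the product of all monic polynomials of degree [k]. *)
Let D k := (carlitz k).['X^k].
Let C k : {poly F} := \prod_(i < k) - D i ^+ q.-1.

Let carlitzS k : carlitz k.+1 = carlitz k ^+ q - (D k ^+ q.-1)%:P * carlitz k.
Proof. by []. Qed.

(** A q-th power has zero derivative here, so each recursion step just multiplies the derivative by
    [- D k ^+ q.-1]. *)
Lemma deriv_carlitz k : (carlitz k)^`() = (C k)%:P.
Proof.
elim: k => [|k IH]; first by rewrite /= derivX /C big_ord0.
rewrite carlitzS derivD derivN derivM derivC mul0r add0r IH deriv_exp.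
rewrite -mulr_natl natr_card ?mul0r ?sub0r; last by move=> p; rewrite !pchar_poly.
by rewrite [in RHS]/C big_ord_recr -/(C k) polyCM polyCN mulrN mulrC.
Qed.

Lemma carlitz_linear k (x y : {poly F}) (c : F) :
  (carlitz k).[x + c%:P * y] = (carlitz k).[x] + c%:P * (carlitz k).[y].
Proof.
elim: k => [|k IH]; first by rewrite /= !hornerX.
rewrite carlitzS !hornerE IH exprD1 exprMn -polyC_exp expf_card.
by ring.
Qed.

Lemma carlitz_expX k i : (i < k)%N -> (carlitz k).['X^i] = 0.
Proof.
elim: k => // k IH; rewrite ltnS leq_eqVlt carlitzS !hornerE => /orP[/eqP->|/IH->].
  by rewrite -/(D k) -exprSr (ltn_predK q_gt1) subrr.
by rewrite expr0n eqn0Ngt q_gt0 mulr0 subrr.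
Qed.

Lemma carlitz0 k : (carlitz k).[0] = 0.
Proof.
elim: k => [|k IH]; first by rewrite hornerX.
by rewrite carlitzS !hornerE IH expr0n eqn0Ngt q_gt0 mulr0 subrr.
Qed.

Lemma carlitz_monic_of k (c : {ffun 'I_k -> F}) : (carlitz k).[monic_of c] = D k.
Proof.
rewrite /monic_of; elim/big_rec: _ => [|i x _ IH]; first by rewrite addr0.
by rewrite addrCA addrC carlitz_linear IH carlitz_expX // mulr0 addr0.
Qed.

(** The gap below the leading term is what keeps the remainder in [powsum_card_exp] short enough to
    sum to zero. *)
Lemma carlitz_sparse k : exists2 T : {poly {poly F}},
  carlitz k = 'X^(q ^ k) + 'X * T & (size T * q <= q ^ k)%N.
Proof.
elim: k => [|k [T ET szT]]; first by exists 0; rewrite ?mulr0 ?addr0 ?size_poly0.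
have qk : (0 < q ^ k)%N by rewrite expn_gt0 q_gt0.
(* With N = q^k, the q-th power of X^N + X T is X^(qN) + X^q T^q; one X is factored out of
   everything but X^(qN). *)
exists ('X^(q.-1) * T ^+ q - (D k ^+ q.-1)%:P * ('X^((q ^ k).-1) + T)).
  rewrite carlitzS ET exprD2 -exprM -expnSr exprMn.
  have -> : 'X^(q ^ k) = 'X * 'X^((q ^ k).-1) :> {poly {poly F}}.
    by rewrite -exprS prednK.
  have -> : 'X^q = 'X * 'X^(q.-1) :> {poly {poly F}} by rewrite -exprS prednK.
  by ring.
rewrite expnSr leq_mul2r; apply/orP; right.
rewrite (leq_trans (size_polyD _ _)) // size_polyN geq_max; apply/andP; split.
  have [->|T0] := eqVneq T 0; first by rewrite expr0n eqn0Ngt q_gt0 mulr0 size_poly0.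
  rewrite mulrC size_mulXn ?expf_neq0 //.
  have := size_poly_exp_leq T q; have := size_poly_gt0 T; rewrite T0.
  by move: (size T) (size _) szT => s t; nia.
have szXT : (size ('X^((q ^ k).-1) + T)%R <= q ^ k)%N.
  rewrite (leq_trans (size_polyD _ _)) // geq_max size_polyXn prednK // leqnn /=.
  by rewrite (leq_trans _ szT) // leq_pmulr.
by rewrite mul_polyC (leq_trans (size_scale_leq _ _)).
Qed.

(** Both sides are monic of degree [q ^ k] and vanish at the same [q ^ k] distinct points, so their
    difference has too many roots for its degree. *)
Lemma prod_monic_of k :
  \prod_(c : {ffun 'I_k -> F}) ('X - (monic_of c)%:P) = carlitz k - (D k)%:P.
Proof.
have [T ET szT] := carlitz_sparse k.
have qk : (0 < q ^ k)%N by rewrite expn_gt0 q_gt0.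
have szr : (size ('X * T - (D k)%:P)%R <= q ^ k)%N.
  rewrite (leq_trans (size_polyD _ _)) // size_polyN geq_max.
  rewrite (leq_trans (size_polyC_leq1 _)) // andbT.
  have [->|T0] := eqVneq T 0; first by rewrite mulr0 size_poly0.
  rewrite mulrC size_mulX //; have := size_poly_gt0 T; rewrite T0.
  by move: (size T) szT => s; have := q_gt1; nia.
have E : carlitz k - (D k)%:P = 'X^(q ^ k) + ('X * T - (D k)%:P) by rewrite ET addrA.
have cardI : #|{ffun 'I_k -> F}| = (q ^ k)%N by rewrite card_ffun card_ord.
set P := \prod_c _.
have mP : P \is monic by apply: monic_prod_XsubC.
have szP : size P = (q ^ k).+1 by rewrite /P size_prod_XsubC -cardI cardT enumT.
apply/eqP; rewrite -subr_eq0; apply/eqP.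
apply: (@roots_geq_poly_eq0 _ _ [seq monic_of c | c : {ffun 'I_k -> F}]).
- apply/allP => _ /mapP[c _ ->].
  rewrite rootE !(hornerD, hornerN, hornerC) carlitz_monic_of subrr subr0.
  by rewrite /P (bigD1 c) //= hornerM hornerXsubC subrr mul0r.
- by rewrite map_inj_uniq ?enum_uniq //; apply: monic_of_inj.
rewrite size_map -cardE cardI; apply/leq_sizeP => j.
rewrite E leq_eqVlt => jk; have kj : (q ^ k <= j)%N by rewrite leq_eqVlt.
have r0 : ('X * T - (D k)%:P : {poly _})`_j = 0 by rewrite nth_default ?(leq_trans szr).
rewrite coefB coefD coefXn r0 addr0.
case/orP: jk => [/eqP<-|jk]; last by rewrite nth_default ?szP // gtn_eqF // subrr.
by have /eqP := mP; rewrite lead_coefE szP eqxx => ->; rewrite subrr.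
Qed.

(** * Power sums over the monic polynomials of degree [k] *)

Let prod_deriv k :
  (\prod_(c : {ffun 'I_k -> F}) ('X - (monic_of c)%:P))^`() = (C k)%:P.
Proof. by rewrite prod_monic_of derivB derivC subr0 deriv_carlitz. Qed.

Let prod0 k : (\prod_(c : {ffun 'I_k -> F}) ('X - (monic_of c)%:P)).[0] = - D k.
Proof. by rewrite prod_monic_of !hornerE carlitz0 sub0r. Qed.

Lemma powsum_eq0 k n : (n.+1 < q ^ k)%N -> powsum F k n = 0.
Proof.
move=> nk; have := @sum_horner_eq0 _ _ _ (@monic_of_inj F k) _ (prod_deriv k) 'X^n.
rewrite size_polyXn card_ffun card_ord => /(_ nk) E.
by rewrite -[RHS]E; apply: eq_bigr => c _; rewrite hornerXn.
Qed.

Lemma powsum_card_exp k :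
  D k ^+ 2 * powsum F k (q ^ k.+1 - 2) = - (- D k) ^+ q * C k ^+ 2.
Proof.
have [T ET szT] := carlitz_sparse k.
have qk : (0 < q ^ k)%N by rewrite expn_gt0 q_gt0.
have qk1 : (1 < q ^ k.+1)%N by rewrite expnS; have := q_gt1; nia.
rewrite -(sqrrN (D k)) -prod0.
(* The q-th power of e(a) = [D k] gives a^(q^(k+1)) = - (- D k)^q - a^q T(a)^q; splitting a^q as a^2
   a^(q-2) yields this [f], of size at most q * size T - 1 when T is nonzero. *)
apply: (@sum_expr_of_sq _ _ _ (@monic_of_inj F k) _ (prod_deriv k)
  (@monic_of_neq0 F k) _ _ (- ('X^(q - 2) * T ^+ q))).
  rewrite size_polyN card_ffun card_ord.
  have [->|T0] := eqVneq T 0; first by rewrite expr0n eqn0Ngt q_gt0 mulr0 size_poly0.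
  rewrite mulrC size_mulXn ?expf_neq0 //.
  have := size_poly_exp_leq T q; have := size_poly_gt0 T; rewrite T0.
  rewrite -/q; case: (size T) szT => // t; rewrite /= mulSn => szT _ szTq.
  rewrite (leq_ltn_trans (leq_add (leqnn _) szTq)) //.
  by move: (t * q)%N (q ^ k)%N szT q_gt1 => u v; lia.
move=> c; set a := monic_of c.
have : a ^+ (q ^ k) + a * T.[a] - D k = 0.
  by rewrite -(carlitz_monic_of c) ET !hornerE subrr.
move=> /(congr1 (fun x => x ^+ q)); rewrite !exprD1 -exprM -expnSr exprMn.
rewrite expr0n eqn0Ngt q_gt0 /= => E.
have -> : (q ^ k.+1 - 2).+2 = (q ^ k.+1)%N by lia.
rewrite prod0 hornerN hornerM hornerXn horner_exp mulrN mulrA -exprD subnKC //.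
by apply/eqP; rewrite -subr_eq0; apply/eqP; rewrite -[RHS]E; ring.
Qed.

(** * Degrees of [D k], [C k] and the dominant power sum *)

Lemma size_carlitz_expX k : size (D k) = (k * q ^ k).+1.
Proof.
(* [- D k] is the product evaluated at 0: [q ^ k] factors, each of degree [k]. *)
rewrite -size_polyN -prod0 horner_prod.
under eq_bigr do rewrite hornerXsubC sub0r.
rewrite size_prod => [|c _]; last by rewrite oppr_eq0 monic_of_neq0.
under eq_bigr do rewrite size_polyN size_monic_of.
rewrite sum_nat_const; set N := #|_|.
have -> : N = (q ^ k)%N by rewrite -[k in RHS]card_ord -card_ffun; apply: eq_card.
by rewrite mulnS mulnC subSn ?leq_addr // addKn.
Qed.

Let D_neq0 k : D k != 0.
Proof. by rewrite -size_poly_eq0 size_carlitz_expX. Qed.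

Let C_neq0 k : C k != 0.
Proof. by apply/prodf_neq0 => i _; rewrite oppr_eq0 expf_neq0 ?D_neq0. Qed.

(** The degree of [C k] is (q-1) times the sum of i q^i over i < k, that is k q^k - q(q^k -
    1)/(q-1); denominators and negative terms are cleared to stay in [nat]. *)
Let size_C k : (q.-1 * (size (C k)).-1 + q ^ k.+1 = k * q.-1 * q ^ k + q)%N.
Proof.
elim: k => [|k IH]; first by rewrite /C big_ord0 size_poly1 expn1 muln0.
have -> : (size (C k.+1)).-1 = ((size (C k)).-1 + k * q ^ k * q.-1)%N.
  rewrite /C big_ord_recr -/(C k) size_mul ?oppr_eq0 ?expf_neq0 ?C_neq0 ?D_neq0 //.
  rewrite size_polyN; have := size_exp (D k) q.-1; rewrite size_carlitz_expX /= => <-.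
  have: (0 < size (D k ^+ q.-1))%N by rewrite size_poly_gt0 expf_neq0 ?D_neq0.
  have: (0 < size (C k))%N by rewrite size_poly_gt0 C_neq0.
  by case: (size _) => // s _; case: (size _) => // t _; rewrite addSn addnS.
move: (size _).-1 IH q_gt1 => s; rewrite !expnS; move: (q ^ k)%N => Q.
case: q => // r; rewrite /=; nia.
Qed.

(** By [powsum_card_exp] the degree is (q-2) deg D_k + 2 deg C_k, again with denominators
    cleared. *)
Lemma size_powsum_card_exp k :
  powsum F k (q ^ k.+1 - 2) != 0 /\
  ((size (powsum F k (q ^ k.+1 - 2))).-1 * q.-1 + 2 * q ^ k.+1
   = k * q.-1 * q ^ k.+1 + 2 * q)%N.
Proof.
have := powsum_card_exp k; set S := powsum F k _ => E.
have CD : - (- D k) ^+ q * C k ^+ 2 != 0.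
  by rewrite mulf_neq0 ?oppr_eq0 ?expf_neq0 ?oppr_eq0 ?C_neq0 ?D_neq0.
have S0 : S != 0 by apply: contraNneq CD => S0; rewrite -E S0 mulr0.
split=> //; have /(congr1 (fun p : {poly F} => (size p).-1)) := E.
have sizeM (x y : {poly F}) : x != 0 -> y != 0 ->
    (size (x * y)).-1 = ((size x).-1 + (size y).-1)%N.
  move=> x0 y0; rewrite size_mul //; move: x0 y0; rewrite -!size_poly_gt0.
  by case: (size x) => // s _; case: (size y) => // t _; rewrite addSn addnS.
rewrite !sizeM ?oppr_eq0 ?expf_neq0 ?oppr_eq0 ?C_neq0 ?D_neq0 // size_polyN.
rewrite !size_exp size_polyN size_carlitz_expX /=.
have := size_C k; rewrite expnS; move: (size S).-1 (size (C k)).-1 q_gt1 => s c.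
move: (q ^ k)%N => Q; case: q => // r; rewrite /=; nia.
Qed.

End Carlitz.

(** * The degree of BG, read off from its dominant term *)

Theorem theorem5p3 (F : finFieldType) (d : nat) :
  (2 < #|F|)%N -> (1 <= d)%N ->
  let q := #|F| in
  BG F (q ^ d - 2) != 0 /\
  ((size (BG F (q ^ d - 2))).-1)%:R
    = (d%:R - 1) * (q%:R ^+ d) - 2%:R * q%:R * (q%:R ^+ d.-1 - 1) / (q%:R - 1) :> rat.
Proof.
case: d => // k q_gt2 _ q /=.
have [S0 szS] := size_powsum_card_exp F k; rewrite -/q in S0 szS.
have qk : (0 < q ^ k)%N by rewrite expn_gt0 (ltn_trans _ q_gt2).
have qk2 : (1 < q ^ k.+1)%N by rewrite -{1}(expn0 q) ltn_exp2l // (ltn_trans _ q_gt2).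
(* The dominant index k = d - 1 must lie in the finite range of [BG]. *)
have kn : (k < (q ^ k.+1 - 2).+1)%N.
  have : (k < q ^ k)%N by rewrite ltn_expl // (ltn_trans _ q_gt2).
  by rewrite expnS; move: (q ^ k)%N qk q_gt2 => Q; rewrite -/q; nia.
set S := powsum F k (q ^ k.+1 - 2) in S0 szS.
have szBG : size (BG F (q ^ k.+1 - 2)) = size S.
  rewrite /BG (bigD1 (Ordinal kn)) //= size_polyDl //.
  have S_gt0 : (0 < size S)%N by rewrite size_poly_gt0.
  rewrite -(prednK S_gt0) ltnS (leq_trans (size_sum _ _ _)) //.
  apply/bigmax_leqP => i ik.
  have [ki|ik'] := ltnP k i.
    rewrite powsum_eq0 ?size_poly0 // -/q.
    rewrite (leq_trans _ (_ : q ^ k.+1 <= q ^ i)%N) //; last first.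
      by rewrite leq_exp2l // (ltn_trans _ q_gt2).
    by rewrite -subSn // subSS subn1 ltn_predL ltnW.
  have {ik'} ik : (i < k)%N.
    by rewrite ltn_neqAle ik' andbT; apply: contraNneq ik => ik; apply/eqP/val_inj.
  apply: (leq_trans (size_powsum_leq _ _ _)).
  have : (i * (q ^ k.+1 - 2) <= k.-1 * (q ^ k.+1 - 2))%N by rewrite leq_mul2r; lia.
  move: (nat_of_ord i) ik => {}i ik /leq_ltn_trans; apply.
  (* With N = q^(k+1) and s the degree of [S], (q-1)(s - (k-1)(N-2)) = (q-3)N + 2q + 2(k-1)(q-1),
     which is positive because q >= 3 and k >= 1. *)
  rewrite -(@ltn_pmul2r q.-1); last by rewrite -subn1 subn_gt0 (ltn_trans _ q_gt2).
  move: (size S).-1 szS => s; move: (q ^ k.+1)%N qk2 => N N_gt1 szS.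
  have -> : (N - 2)%N = N.-2 by lia.
  move: ik szS N_gt1 q_gt2; rewrite -/q; clearbody q; clear => ik szS N_gt1 q_gt2.
  case: k ik szS => // j _; case: N N_gt1 => [|[|N]] // _.
  by case: q q_gt2 => [|[|[|r]]] //= _; nia.
split; first by rewrite -size_poly_gt0 szBG size_poly_gt0.
rewrite szBG; move: (size S).-1 szS => s szS.
have q1 : (q%:R - 1 : rat) != 0.
  by rewrite subr_eq0 Num.Theory.pnatr_eq1 gtn_eqF // (ltn_trans _ q_gt2).
have : ((s * q.-1 + 2 * q ^ k.+1)%:R = (k * q.-1 * q ^ k.+1 + 2 * q)%:R :> rat).
  by rewrite szS.
rewrite !natrD !natrM !natrX -subn1 natrB; last by rewrite (ltn_trans _ q_gt2).
move=> /(canRL (addrK _)) E.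
by apply: (mulIf q1); rewrite mulrBl divfK // E exprS; ring.
Qed.
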